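(* Let $\lambda$ and $\nu$ be integer partitions, and let $M_{\lambda\nu}$ be the number of $(0,1)$-matrices with row sums $\lambda$ and column sums $\nu$. Then $$M_{\lambda\nu}=\frac{\prod_{i\ge1}m_i(\lambda)!}{\prod_{i\ge1}\nu_i!}\sum_{T\in\mathrm{SSYT}(\lambda',\nu)}\left(\prod_{i\ge2}\prod_{j\ge1}r_{ij}(T)\right)\prod_{i\ge1}\binom{\nu_i}{\beta^i(T)}.$$
   Context: $\lambda'$ is the conjugate of $\lambda$ and $m_i(\lambda)$ is the multiplicity of $i$ as a part of $\lambda$. The matrices counted by $M_{\lambda\nu}$ have size $\ell(\lambda)\times\ell(\nu)$, with $i$-th row sum $\lambda_i$ and $j$-th column sum $\nu_j$. $\mathrm{SSYT}(\mu,\nu)$ is the set of semistandard tableaux of shape $\mu$ and content $\nu$ (rows weakly increasing, columns strictly increasing, entry $i$ appearing exactly $\nu_i$ times). For $T$ with entry $b_{ij}$ in row $i$ and column $j$, $r_{ij}(T)=\#\{j':j'\ge j,\ b_{i-1,j'}<b_{ij}\}$ for each cell $(i,j)$ of $T$ with $i\ge2$; the double product is over the cells $(i,j)$ of $T$ with $i\ge2$. $\beta^i(T)=(\beta^i_1,\beta^i_2,\ldots)$ where $\beta^i_j$ is the number of occurrences of $i$ in the $j$-th row of $T$, and $\binom{\nu_i}{\beta^i(T)}=\nu_i!/\prod_j\beta^i_j!$ is the multinomial coefficient. *)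

(* Defs.v *)
From HB Require Import structures.
From mathcomp Require Import all_boot all_order all_algebra.

Set Implicit Arguments.
Unset Strict Implicit.
Unset Printing Implicit Defensive.

Import GRing.Theory Num.Theory.

(* All indices are shifted to start at 0: part lambda_i is [nth 0 lam (i - 1)],
   and the entries of a tableau of content nu are 0, ..., size nu - 1, the
   entry i of the usual convention being represented by i - 1. *)

Definition is_partition (lam : seq nat) : bool :=
  sorted geq lam && (0 \notin lam).

Definition conj_part (lam : seq nat) : seq nat :=
  mkseq (fun i => count (fun p => i < p) lam) (head 0 lam).

Definition M01 (lam nu : seq nat) : nat :=
  #|[set A : 'M[bool]_(size lam, size nu) |
      [forall i, \sum_j A i j == nth 0 lam i] &&
      [forall j, \sum_i A i j == nth 0 nu j]]|.

Definition cell (mu : seq nat) : finType :=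
  {c : 'I_(size mu) * 'I_(head 0 mu) | c.2 < nth 0 mu c.1}.

Definition row_of (mu : seq nat) (c : cell mu) : nat := (val c).1.
Definition col_of (mu : seq nat) (c : cell mu) : nat := (val c).2.

Definition filling (mu nu : seq nat) : finType :=
  {ffun cell mu -> 'I_(size nu)}.

Definition SSYT (mu nu : seq nat) : {set filling mu nu} :=
  [set T : filling mu nu |
    [&& [forall c, forall d,
          (row_of c == row_of d) && (col_of c <= col_of d) ==> (T c <= T d)],
        [forall c, forall d,
          (col_of c == col_of d) && (row_of c < row_of d) ==> (T c < T d)]
      & [forall i, #|[set c | T c == i]| == nth 0 nu i]]].

Definition rstat (mu nu : seq nat) (T : filling mu nu) (c : cell mu) : nat :=
  #|[set d : cell mu |
      [&& (row_of d).+1 == row_of c, col_of c <= col_of d & T d < T c]]|.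

Definition beta (mu nu : seq nat) (T : filling mu nu)
    (i : 'I_(size nu)) (j : nat) : nat :=
  #|[set c : cell mu | (row_of c == j) && (T c == i)]|.

Definition beta_multinomial (mu nu : seq nat) (T : filling mu nu)
    (i : 'I_(size nu)) : rat :=
  (((nth 0 nu i)`!)%N%:R / (\prod_(j < size mu) (beta T i j)`!)%N%:R)%R.

(* Main.v *)
Require Import Defs.
From mathcomp Require Import all_boot all_order all_fingroup all_algebra.
From mathcomp Require Import zify ring.

(* Let mu be the conjugate of lam. Reading the rows of a 0-1 matrix as sets of
   column indices and listing each set down a column of the diagram of mu
   identifies the matrices with the column-strict fillings of shape mu and
   content nu. Sorting the rows of such a filling gives a semistandard tableau,
   so it suffices to count, for T semistandard, the column-strict fillings U
   whose rows rearrange those of T.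
   Count tuples (s_i) of permutations of the rows such that T o s is
   column-strict. Each U arises from prod beta! tuples. On the other hand,
   column-strictness between rows i and i+1 only depends on
   t_i = s_i o s_(i+1)^-1; the t_i can be chosen independently, and since the
   sets of entries of row i that are smaller than a given entry of row i+1 form
   a chain, there are (mu_i - mu_(i+1))! * prod_j r_(i+1,j) choices for t_i. *)

Set Implicit Arguments.
Unset Strict Implicit.
Unset Printing Implicit Defensive.

(** * Permutations with constrained values *)

Lemma sum_ord_lt (w s : nat) (F : nat -> nat) : s <= w ->
  \sum_(x < w | x < s) F x = \sum_(0 <= x < s) F x.
Proof. by move=> le_sw; rewrite [RHS]big_mkord -(big_ord_widen _ F le_sw). Qed.

Section ConstrainedPermutations.

Variables (w s : nat) (A : nat -> pred nat) (R : rel nat).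
Hypothesis le_sw : s <= w.

(** All rows are permuted within one group ['S_w], with support in the first [s] points, so that
    permutations of rows of different lengths can be multiplied. Constraining only the first [m]
    values allows induction on [m]. *)
Definition constrained_perms m : {set 'S_w} :=
  [set t : 'S_w | perm_on [set x : 'I_w | x < s] t &
    [forall j : 'I_w, (j < m) ==> A j (t j)]].

Lemma constrained_permsP m (t : 'S_w) :
  reflect (perm_on [set x : 'I_w | x < s] t /\
           forall j : 'I_w, j < m -> A j (t j))
    (t \in constrained_perms m).
Proof.
rewrite inE; apply: (iffP andP) => -[st H]; split=> //.
  by move=> j ltjm; have /forallP/(_ j) := H; rewrite ltjm.
by apply/forallP=> j; apply/implyP/H.
Qed.

(* Both sides count the pairs (t, k) with t in [constrained_perms m],
   m <= k < s and A m (t k): composing with the transposition of m and k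
   shows that every k contributes #|constrained_perms m.+1|. *)
Lemma constrained_perms_step m : m < s ->
  (forall j x, j < m -> x < s -> A j x -> A m x = R j m) ->
  (s - m) * #|constrained_perms m.+1| =
  #|constrained_perms m| *
    (\sum_(0 <= x < s) A m x - \sum_(0 <= j < m) R j m).
Proof.
move=> lt_ms AR; have lt_mw := leq_trans lt_ms le_sw.
pose m' := Ordinal lt_mw.
pose X := constrained_perms m.
transitivity (\sum_(k < w | (k < s) && (m <= k)) \sum_(t in X) A m (t k)).
  transitivity (\sum_(k < w | (k < s) && (m <= k)) #|constrained_perms m.+1|).
    rewrite sum_nat_const; congr (_ * _).
    rewrite -sum1_card -(big_geq_mkord m w (fun k => k < s) (fun=> 1)).
    by rewrite -(muln1 (s - m)) -sum_nat_const_nat (big_nat_widen _ _ _ _ _ le_sw).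
  apply: eq_bigr => k /andP[lt_ks le_mk].
  rewrite -sum1_card [RHS](reindex_inj (mulgI (tperm m' k))) /=.
  rewrite -big_mkcondr /=; apply: eq_bigl => t.
  rewrite /= permM tpermR; apply/constrained_permsP/andP.
    move=> [st At]; split; last exact: (At m' (ltnSn m)).
    apply/constrained_permsP; split; last first.
      move=> j lt_jm; rewrite permM tpermD ?At //; first exact: leqW.
        by rewrite -val_eqE /=; lia.
      by rewrite -val_eqE /=; lia.
    apply: perm_onM => //.
    apply/subsetP=> x; rewrite !inE; by case: tpermP => [-> | -> | _ _] //; rewrite eqxx.
  move=> [/constrained_permsP [st At] Atm]; split.
    have ->: t = (tperm m' k * (tperm m' k * t))%g by rewrite mulgA tperm2 mul1g.
    apply: perm_onM => //.
    apply/subsetP=> x; rewrite !inE; by case: tpermP => [-> | -> | _ _] //; rewrite eqxx.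
  move=> j; rewrite ltnS leq_eqVlt => /orP[/eqP eq_jm | lt_jm].
    by have ->: j = m' by [apply: val_inj]; rewrite -/m' /=.
  have := At j lt_jm; rewrite permM tpermD //.
    by rewrite -val_eqE /=; lia.
  by rewrite -val_eqE /=; lia.
rewrite exchange_big /= -sum_nat_const; apply: eq_bigr.
move=> t /constrained_permsP[st At].
have sumA: \sum_(0 <= x < s) A m x = \sum_(k < w | k < s) A m (t k).
  rewrite -(sum_ord_lt (A m) le_sw) (reindex_inj (@perm_inj _ t)) /=.
  apply: eq_bigl => k; have := perm_closed k st.
  by rewrite !inE.
(* For [k < m] the constraint [A k (t k)] makes [A m (t k)] equal to [R k m]. These terms are part
   of the sum, so the truncated subtraction is exact. *)
rewrite sumA [in RHS](bigID (fun k : 'I_w => m <= k)) /=.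
have ->: \sum_(k < w | (k < s) && ~~ (m <= k)) A m (t k) =
         \sum_(0 <= j < m) R j m.
  rewrite -(sum_ord_lt (R^~ m) (ltnW lt_mw)).
  apply: eq_big => [k | k /andP[lt_ks lt_km]].
    by rewrite -ltnNge; lia.
  rewrite -ltnNge in lt_km; rewrite (AR k (t k)) //; last exact: At.
  by have := perm_closed k st; rewrite !inE lt_ks.
by rewrite addnK.
Qed.

(* The two uses are chains of sets (R everywhere true) and the level sets of a
   function (R j k stating that the j-th and k-th sets coincide). *)
Lemma card_constrained_perms m : m <= s ->
  (forall j k x, j < k < m -> x < s -> A j x -> A k x = R j k) ->
  #|constrained_perms m| =
  (s - m)`! *
    \prod_(0 <= k < m) (\sum_(0 <= x < s) A k x - \sum_(0 <= j < k) R j k).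
Proof.
elim: m => [|m IHm] le_ms AR.
  rewrite big_nil muln1 subn0.
  have ->: constrained_perms 0 = [set t | perm_on [set x : 'I_w | x < s] t].
    by apply/setP=> t; rewrite !inE andb_idr // => _; apply/forallP.
  rewrite cardsE card_perm -sum1dep_card (sum_ord_lt (fun=> 1) le_sw).
  by rewrite sum_nat_const_nat subn0 muln1.
have := constrained_perms_step le_ms.
rewrite IHm => [E||j k x /andP[lt_jk lt_km]]; first last.
- by apply: AR; rewrite lt_jk ltnW.
- exact: ltnW.
have s_gt: 0 < s - m by rewrite subn_gt0.
apply/eqP; rewrite -(eqn_pmul2l s_gt) E => [|j x lt_jm]; last first.
  by apply: AR; rewrite lt_jm ltnSn.
by rewrite big_nat_recr //= -[in (s - m)`!](subnSK le_ms) factS subnSK // !mulnA.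
Qed.

End ConstrainedPermutations.

(** The sets of [x] with [a x < b j] grow with [j], so the [j] values chosen earlier all lie in the
    current set and are excluded. *)
Lemma card_perms_below (w s m : nat) (a b : nat -> nat) :
  m <= s -> s <= w -> (forall j k, j <= k < m -> b j <= b k) ->
  #|[set t : 'S_w | perm_on [set x : 'I_w | x < s] t &
      [forall j : 'I_w, (j < m) ==> (a (t j) < b j)]]| =
  (s - m)`! * \prod_(0 <= j < m) (\sum_(0 <= x < s) (a x < b j) - j).
Proof.
move=> le_ms le_sw b_mono.
rewrite (@card_constrained_perms w s (fun j x => a x < b j) (fun _ _ => true)) //.
  by congr (_ * _); apply: eq_bigr => j _; rewrite sum_nat_const_nat muln1 subn0.
move=> j k x /andP[lt_jk lt_km] _ /leq_trans; apply.
by apply: b_mono; rewrite ltnW.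
Qed.

(** The indices [j] with [b j = k], taken in order, contribute [c k], [c k - 1], and so on: a
    falling factorial. *)
Lemma prod_ffact_rank (n m : nat) (c b : nat -> nat) :
  (forall j, j < m -> b j < n) ->
  \prod_(0 <= j < m) (c (b j) - \sum_(0 <= i < j) (b i == b j)) =
  \prod_(k < n) c k ^_ (\sum_(0 <= j < m) (b j == k)).
Proof.
elim: m => [|m IHm] b_lt.
  by rewrite big_nil big1 // => k _; rewrite big_nil.
rewrite big_nat_recr //= IHm => [|j lt_jm]; last by apply: b_lt; apply: leqW.
pose bm := Ordinal (b_lt m (ltnSn m)).
rewrite (bigD1 bm) // [in RHS](bigD1 bm) //= big_nat_recr //= eqxx addn1 ffactnSr.
rewrite mulnAC; congr (_ * _); apply: eq_bigr => k neq_k.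
rewrite big_nat_recr //=; have /negPf->: b m != k by rewrite eq_sym.
by rewrite addn0.
Qed.

(** Such a [t] injects each fibre of [b] into the fibre of [a] over the same value, independently
    for each value. *)
Lemma card_perms_matching (w s n : nat) (a b : nat -> nat) :
  s <= w -> (forall j, j < s -> b j < n) ->
  #|[set t : 'S_w | perm_on [set x : 'I_w | x < s] t &
      [forall j : 'I_w, (j < s) ==> (b j == a (t j))]]| =
  \prod_(k < n) (\sum_(0 <= x < s) (a x == k)) ^_ (\sum_(0 <= x < s) (b x == k)).
Proof.
move=> le_sw b_lt.
rewrite (@card_constrained_perms w s (fun j x => b j == a x) (fun i j => b i == b j)) //.
  rewrite subnn mul1n -(prod_ffact_rank (fun k => \sum_(0 <= x < s) (a x == k))) //.
  apply: eq_bigr => j _; congr (_ - _); apply: eq_bigr => i _.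
  by rewrite eq_sym.
by move=> j k x _ _ /eqP->; rewrite eq_sym.
Qed.

(** * Telescoping quotients in a descending chain of groups *)

Section Telescoping.

Variables (gT : finGroupType) (h : nat).
Implicit Type sigma : {ffun 'I_h -> gT}.

(* The junk value 1 beyond the last index makes the last quotient equal to the
   last entry, so that quotients determine the whole family. *)
Definition ext1 sigma (k : nat) : gT := oapp sigma 1%g (insub k).

Lemma ext1_ord sigma (i : 'I_h) : ext1 sigma i = sigma i.
Proof. by rewrite /ext1 valK. Qed.

Lemma ext1_ge sigma k : h <= k -> ext1 sigma k = 1%g.
Proof. by move=> le_hk; rewrite /ext1 insubN // -leqNgt. Qed.

(** Permutations multiply from left to right, so for them this is [sigma i] applied after the
    inverse of its successor. *)
Definition quotients sigma : {ffun 'I_h -> gT} :=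
  [ffun i : 'I_h => ((ext1 sigma i.+1)^-1 * sigma i)%g].

Lemma ext1_quotients sigma (i : 'I_h) :
  sigma i = (ext1 sigma i.+1 * quotients sigma i)%g.
Proof. by rewrite ffunE mulKVg. Qed.

Lemma quotients_inj : injective quotients.
Proof.
move=> s1 s2 eq_q.
(* Induction on a bound [d] for the distance from [k] to the end [h], where both extensions are
   1. *)
suff eq_ext d k : h - k <= d -> ext1 s1 k = ext1 s2 k.
  by apply/ffunP=> i; rewrite -!ext1_ord; apply: eq_ext (leqnn _).
elim: d k => [|d IHd] k le_d; have [le_hk | lt_kh] := leqP h k.
- by rewrite !ext1_ge.
- lia.
- by rewrite !ext1_ge.
have := ext1_ord s1 (Ordinal lt_kh); have := ext1_ord s2 (Ordinal lt_kh) => /= -> ->.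
rewrite (ext1_quotients s1) (ext1_quotients s2) /= eq_q.
by congr (_ * _)%g; apply: IHd; lia.
Qed.

(** As an injective self-map of a finite type, [quotients] is bijective. Since the groups descend, a
    family lies in their product exactly when its quotients do, and the quotients can be chosen
    independently. *)
Lemma card_telescope (H : nat -> {group gT}) (P : nat -> pred gT) :
  (forall i, H i.+1 \subset H i) ->
  #|[set sigma : {ffun 'I_h -> gT} |
      [forall i : 'I_h, sigma i \in H i] &&
      [forall i : 'I_h, P i ((ext1 sigma i.+1)^-1 * sigma i)%g]]| =
  \prod_(i < h) #|[set t in H i | P i t]|.
Proof.
move=> HS.
pose Q (i : 'I_h) := [set t in H i | P i t].
transitivity #|family (fun i => mem (Q i))|; last first.
  by rewrite card_family foldrE big_image.
rewrite -[RHS]cardsE -[RHS](card_preimset _ quotients_inj).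
apply: eq_card => sigma; rewrite !inE.
apply/andP/familyP.
  move=> [/forallP sH /forallP sP] i; rewrite !inE ffunE sP andbT.
  rewrite groupM // groupV; have [le_h | lt_ih] := leqP h i.+1.
    by rewrite ext1_ge.
  by rewrite (ext1_ord sigma (Ordinal lt_ih)) (subsetP (HS i)) ?(sH (Ordinal lt_ih)).
move=> qH; split; apply/forallP=> i; last first.
  by have := qH i; rewrite !inE ffunE => /andP[].
suff extH d k : h - k <= d -> ext1 sigma k \in H k.
  by rewrite -ext1_ord; apply: extH (leqnn _).
elim: d k => [|d IHd] k le_d; have [le_hk | lt_kh] := leqP h k.
- by rewrite ext1_ge.
- lia.
- by rewrite ext1_ge.
rewrite (ext1_ord sigma (Ordinal lt_kh)) ext1_quotients groupM //=.
  by rewrite (subsetP (HS k)) // IHd //; lia.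
by have := qH (Ordinal lt_kh); rewrite !inE => /andP[].
Qed.

End Telescoping.

(** * Indicator sums and thresholds *)

Lemma sum_nat_pred1 (m i : nat) (F : nat -> nat) : i < m ->
  \sum_(0 <= k < m) (k == i) * F k = F i.
Proof.
move=> lt_im; rewrite big_mkord (bigD1 (Ordinal lt_im)) //= eqxx mul1n.
by rewrite big1 ?addn0 // => k /negPf neq_k; rewrite -[_ == i]/(k == Ordinal lt_im) neq_k.
Qed.

Lemma sum_nat_ltn (m t : nat) : t <= m -> \sum_(0 <= k < m) (k < t) = t.
Proof.
move=> le_tm; rewrite (big_cat_nat _ le_tm) //= big_nat (eq_bigr (fun=> 1)).
  rewrite -big_nat sum_nat_const_nat subn0 muln1 [X in _ + X]big_nat big1 ?addn0 //.
  by move=> k /andP[le_tk _]; rewrite ltnNge le_tk.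
by move=> k /andP[_ ->].
Qed.

(** Builds entries from prescribed counts: if [N x] is to be the number of entries below [x] in a
    row or column, then [k] is the entry at position [t]. *)
Lemma threshold_exists (n t : nat) (N : nat -> nat) :
  {homo N : x y / x <= y} -> N 0 <= t < N n ->
  exists k : 'I_n, forall x, (k < x) = (t < N x).
Proof.
move=> N_mono /andP[N0 Nn].
have exN: exists x, t < N x by exists n.
case: (ex_minnP exN) => -[|k] Nk k_min; first by move: Nk; rewrite ltnNge N0.
have lt_kn := k_min _ Nn; exists (Ordinal lt_kn) => x /=.
apply/idP/idP => [/N_mono|]; first exact: leq_trans.
exact: k_min.
Qed.

(** * Cells and fillings *)

Section Cells.

Variable mu : seq nat.
Hypothesis mu_anti : forall i, nth 0 mu i.+1 <= nth 0 mu i.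

Lemma nth_part_anti i k : i <= k -> nth 0 mu k <= nth 0 mu i.
Proof.
move=> /subnKC <-; elim: (k - i) => [|d IHd]; first by rewrite addn0.
by rewrite addnS (leq_trans (mu_anti _)).
Qed.

Lemma nth_part_le_head i : nth 0 mu i <= head 0 mu.
Proof. by rewrite -nth0 nth_part_anti. Qed.

Lemma nth_part_gt0 i j : j < nth 0 mu i -> i < size mu.
Proof. by apply: contraTT; rewrite -!leqNgt => /(nth_default 0) ->. Qed.

Lemma col_of_lt (c : cell mu) : col_of c < nth 0 mu (row_of c).
Proof. exact: valP c. Qed.

Lemma cell_eq (c d : cell mu) :
  row_of c = row_of d -> col_of c = col_of d -> c = d.
Proof.
move=> eq_row eq_col; apply: val_inj.
by rewrite [val c]surjective_pairing [val d]surjective_pairing; congr (_, _); apply: val_inj.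
Qed.

Lemma cell_exists i j : j < nth 0 mu i ->
  exists c : cell mu, row_of c = i /\ col_of c = j.
Proof.
move=> lt_j; have lt_i := nth_part_gt0 lt_j.
have lt_jw := leq_trans lt_j (nth_part_le_head i).
have Pc: (Ordinal lt_i, Ordinal lt_jw).2 < nth 0 mu (Ordinal lt_i, Ordinal lt_jw).1 by [].
by exists (exist (fun c : 'I_(size mu) * 'I_(head 0 mu) => c.2 < nth 0 mu c.1) _ Pc).
Qed.

Lemma big_cell (R : Type) (idx : R) (op : Monoid.com_law idx) (F : nat -> nat -> R) :
  \big[op/idx]_(c : cell mu) F (row_of c) (col_of c) =
  \big[op/idx]_(0 <= i < size mu) \big[op/idx]_(0 <= j < nth 0 mu i) F i j.
Proof.
rewrite -(big_sub (fun c : 'I_(size mu) * 'I_(head 0 mu) => c.2 < nth 0 mu c.1)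
  (fun c => F c.1 c.2)) /=.
rewrite (eq_bigl (fun c : 'I_(size mu) * 'I_(head 0 mu) => xpredT c.1 && (c.2 < nth 0 mu c.1))) //.
rewrite -(pair_big_dep xpredT (fun (i : 'I_(size mu)) (j : 'I_(head 0 mu)) => j < nth 0 mu i)
  (fun i j => F i j)).
rewrite big_mkord; apply: eq_bigr => i _; rewrite big_mkord.
by rewrite (big_ord_widen _ (F i) (nth_part_le_head i)).
Qed.

Lemma card_cell (P : nat -> nat -> bool) :
  #|[set c : cell mu | P (row_of c) (col_of c)]| =
  \sum_(0 <= i < size mu) \sum_(0 <= j < nth 0 mu i) P i j.
Proof.
rewrite -big_cell -sum1dep_card big_mkcond /=.
by apply: eq_bigr => c _; case: (P _ _).
Qed.

Lemma card_cell_row i (P : pred nat) :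
  #|[set c : cell mu | (row_of c == i) && P (col_of c)]| =
  \sum_(0 <= j < nth 0 mu i) P j.
Proof.
rewrite (card_cell (fun i' j => (i' == i) && P j)).
under eq_bigr => i' _ do under eq_bigr => j _ do rewrite -mulnb.
under eq_bigr => i' _ do rewrite -big_distrr /=.
have [le_i | lt_i] := leqP (size mu) i; last first.
  by rewrite (sum_nat_pred1 (fun i' => \sum_(0 <= j < nth 0 mu i') P j)).
rewrite [in RHS]nth_default // big_nil big_nat big1 // => i' /andP[_ lt_i'].
by rewrite ltn_eqF // (leq_trans lt_i').
Qed.

Lemma card_cell_row_lt i m : m <= nth 0 mu i ->
  #|[set c : cell mu | (row_of c == i) && (col_of c < m)]| = m.
Proof. by move=> le_m; rewrite (card_cell_row i (fun j => j < m)) sum_nat_ltn. Qed.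

Lemma card_cell_col_lt j m : (forall i, i < m -> j < nth 0 mu i) ->
  #|[set c : cell mu | (col_of c == j) && (row_of c < m)]| = m.
Proof.
move=> lt_j; rewrite (card_cell (fun i j' => (j' == j) && (i < m))).
have le_m: m <= size mu.
  by case: m lt_j => // m lt_j; apply: (@nth_part_gt0 _ j); apply: lt_j.
rewrite -[RHS](sum_nat_ltn le_m); apply: eq_bigr => i _.
under eq_bigr => k _ do rewrite -mulnb.
have [lt_im | _] := ltnP i m; last by rewrite big1 // => k _; rewrite muln0.
exact: (sum_nat_pred1 (fun=> 1) (lt_j i lt_im)).
Qed.

End Cells.

Section Fillings.

Variables mu nu : seq nat.
Hypothesis mu_anti : forall i, nth 0 mu i.+1 <= nth 0 mu i.
Implicit Types T U : filling mu nu.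

(* [entry T i j] is 0 when (i, j) is not a cell. *)
Definition entry T (i j : nat) : nat :=
  \sum_(c : cell mu | (row_of c == i) && (col_of c == j)) T c.

Lemma entryE T c : entry T (row_of c) (col_of c) = T c.
Proof. by rewrite /entry (big_pred1 c). Qed.

Lemma entry_lt T i j : j < nth 0 mu i -> entry T i j < size nu.
Proof. by move=> /(cell_exists mu_anti)[c [<- <-]]; rewrite entryE. Qed.

Definition colstrict T : bool :=
  [forall c : cell mu, forall d : cell mu,
    (col_of c == col_of d) && (row_of c < row_of d) ==> (T c < T d)].

Definition rowsorted T : bool :=
  [forall c : cell mu, forall d : cell mu,
    (row_of c == row_of d) && (col_of c <= col_of d) ==> (T c <= T d)].

Definition colstrict_fillings : {set filling mu nu} :=
  [set T | colstrict T & [forall i, #|[set c | T c == i]| == nth 0 nu i]].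

(** Adjacent rows suffice: row lengths decrease, so no cell is missing between two cells of a column
    and the inequalities chain. *)
Lemma colstrictP T :
  reflect (forall i j, j < nth 0 mu i.+1 -> entry T i j < entry T i.+1 j)
    (colstrict T).
Proof.
apply: (iffP idP) => [/forallP colT i j lt_j | entT].
  have [d [rd cd]] := cell_exists mu_anti lt_j.
  have [c [rc cc]] := cell_exists mu_anti (leq_trans lt_j (mu_anti i)).
  have /forallP/(_ d)/implyP := colT c; rewrite rc rd cc cd eqxx ltnSn => /(_ isT).
  by rewrite -!entryE rc rd cc cd.
have ent_lt i j k : j < nth 0 mu (i + k.+1) -> entry T i j < entry T (i + k.+1) j.
  elim: k => [|k IHk]; first by rewrite addn1; apply: entT.
  rewrite addnS => lt_j; apply: leq_trans (entT _ _ lt_j).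
  by rewrite ltnS ltnW // IHk // (leq_trans lt_j).
apply/forallP=> c; apply/forallP=> d; apply/implyP=> /andP[/eqP eq_col lt_row].
rewrite -!entryE eq_col -(subnKC lt_row) addSnnS ent_lt //.
by rewrite -addSnnS subnKC // col_of_lt.
Qed.

Lemma rowsortedP T :
  reflect (forall i j j', j <= j' < nth 0 mu i -> entry T i j <= entry T i j')
    (rowsorted T).
Proof.
apply: (iffP idP) => [/forallP rowT i j j' /andP[le_j lt_j'] | entT].
  have [d [rd cd]] := cell_exists mu_anti lt_j'.
  have [c [rc cc]] := cell_exists mu_anti (leq_ltn_trans le_j lt_j').
  have /forallP/(_ d)/implyP := rowT c; rewrite rc rd cc cd eqxx le_j => /(_ isT).
  by rewrite -!entryE rc rd cc cd.
apply/forallP=> c; apply/forallP=> d; apply/implyP=> /andP[/eqP eq_row le_col].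
by rewrite -!entryE eq_row entT // le_col col_of_lt.
Qed.

Lemma SSYT_E T :
  (T \in SSYT mu nu) = rowsorted T && (T \in colstrict_fillings).
Proof. by rewrite !inE. Qed.

Lemma beta_entry T (k : 'I_(size nu)) i :
  beta T k i = \sum_(0 <= j < nth 0 mu i) (entry T i j == k).
Proof.
rewrite -(card_cell_row mu_anti i (fun j => entry T i j == k)).
by apply: eq_card => c; rewrite !inE; case: eqP => //= <-; rewrite entryE.
Qed.

Lemma sum_beta_content T (k : 'I_(size nu)) :
  \sum_(i < size mu) beta T k i = #|[set c | T c == k]|.
Proof.
rewrite -sum1_card (partition_big (fun c : cell mu => (val c).1) xpredT) //=.
by apply: eq_bigr => i _; rewrite /beta -sum1_card; apply: eq_bigl => c; rewrite !inE andbC.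
Qed.

Lemma sum_beta_row T i : \sum_(k < size nu) beta T k i = nth 0 mu i.
Proof.
under eq_bigr => k _ do rewrite beta_entry.
rewrite exchange_big /= big_nat (eq_bigr (fun=> 1)).
  by rewrite -big_nat sum_nat_const_nat subn0 muln1.
move=> j /andP[_ /entry_lt-/(_ T) lt_n].
rewrite (bigD1 (Ordinal lt_n)) //= eqxx big1 ?addn0 // => k.
by rewrite -val_eqE /= eq_sym => /negPf->.
Qed.

Definition same_rows U T : bool :=
  [forall k : 'I_(size nu), forall i : 'I_(size mu), beta U k i == beta T k i].

Lemma same_rowsP U T :
  reflect (forall k (i : 'I_(size mu)), beta U k i = beta T k i) (same_rows U T).
Proof.
by apply: (iffP forallP) => [H k i | H k];
  [exact/eqP/(forallP (H k)) | apply/forallP=> i; exact/eqP].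
Qed.

(** A nonzero product forces [beta U k i <= beta T k i] everywhere. Both sides have the same sum
    over [k], the length of row [i], so they agree. *)
Lemma prod_ffact_beta U T :
  \prod_(i < size mu) \prod_(k < size nu) beta T k i ^_ beta U k i =
  if same_rows U T then \prod_(i < size mu) \prod_(k < size nu) (beta T k i)`!
  else 0.
Proof.
case: same_rowsP => [sUT | neqUT].
  by apply: eq_bigr => i _; apply: eq_bigr => k _; rewrite sUT ffactnn.
apply/eqP; apply: contraT => nz_prod; case: neqUT => k i; apply/eqP.
have le_beta l : beta U l i <= beta T l i.
  rewrite leqNgt; apply: contra nz_prod => lt_beta.
  by rewrite (bigD1 i) //= (bigD1 l) //= ffact_small.
have [_] := leqif_sum (fun l (_ : predT l) => leqif_eq (le_beta l)).
by rewrite !sum_beta_row eqxx => /esym/forallP/(_ k).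
Qed.

Lemma card_beta_lt T i x :
  #|[set c : cell mu | (row_of c == i) && (T c < x)]| =
  \sum_(k < size nu | k < x) beta T k i.
Proof.
rewrite -sum1_card (partition_big (fun c : cell mu => T c) (fun k : 'I_(size nu) => k < x)) /=.
  apply: eq_bigr => k lt_kx; rewrite /beta -sum1_card; apply: eq_bigl => c.
  rewrite !inE -andbA; case: eqP => //= _.
  by case: eqP => [->|]; rewrite ?andbF // lt_kx.
by move=> c; rewrite inE => /andP[].
Qed.

(** The entries below [x] fill an initial segment of a sorted row, so cumulative counts determine
    the row. *)
Lemma rowsorted_lt T c x : rowsorted T ->
  (T c < x) = (col_of c < #|[set d | (row_of d == row_of c) && (T d < x)]|).
Proof.
move=> /forallP rowT; apply/idP/idP => [lt_x | ].
  rewrite -{1}(card_cell_row_lt mu_anti (col_of_lt c)) subset_leq_card //.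
  apply/subsetP=> d; rewrite !inE ltnS => /andP[/eqP eq_r le_c].
  rewrite eq_r eqxx (leq_ltn_trans _ lt_x) //.
  by have /forallP/(_ c)/implyP := rowT d; apply; rewrite eq_r eqxx.
apply: contraTT; rewrite -!leqNgt => le_x.
rewrite -[X in _ <= X](card_cell_row_lt mu_anti (ltnW (col_of_lt c))) subset_leq_card //.
apply/subsetP=> d; rewrite !inE => /andP[/eqP eq_r lt_x].
rewrite eq_r eqxx ltnNge; apply: contraL lt_x => le_c; rewrite -leqNgt.
apply: leq_trans le_x _.
by have /forallP/(_ d)/implyP := rowT c; apply; rewrite eq_r eqxx.
Qed.

(** The column analogue: the entries below [x] occupy the top cells of the column. *)
Lemma colstrict_lt T c x : colstrict T ->
  (T c < x) = (row_of c < #|[set d | (col_of d == col_of c) && (T d < x)]|).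
Proof.
move=> /forallP colT.
have lt_cols m : m <= (row_of c).+1 -> forall i, i < m -> col_of c < nth 0 mu i.
  move=> le_m i lt_i; apply: leq_trans (col_of_lt c) _.
  by apply: nth_part_anti; rewrite // -ltnS (leq_trans lt_i).
apply/idP/idP => [lt_x | ].
  rewrite -{1}(card_cell_col_lt mu_anti (lt_cols _ (leqnn _))) subset_leq_card //.
  apply/subsetP=> d; rewrite !inE ltnS leq_eqVlt => /andP[/eqP eq_c].
  rewrite eq_c eqxx => /orP[/eqP eq_r | lt_r]; first by rewrite (cell_eq eq_r).
  apply: ltn_trans lt_x; have /forallP/(_ c)/implyP := colT d; apply.
  by rewrite eq_c eqxx.
apply: contraTT; rewrite -!leqNgt => le_x.
rewrite -[X in _ <= X](card_cell_col_lt mu_anti (lt_cols _ (leqnSn _))) subset_leq_card //.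
apply/subsetP=> d; rewrite !inE => /andP[/eqP eq_c lt_x].
rewrite eq_c eqxx ltnNge leq_eqVlt; apply: contraL lt_x; rewrite -leqNgt.
case/orP=> [/eqP eq_r | lt_r]; first by rewrite (@cell_eq _ d c).
apply: leq_trans le_x (ltnW _); have /forallP/(_ d)/implyP := colT c; apply.
by rewrite eq_c eqxx.
Qed.

End Fillings.

(** * Sorting the rows of a column-strict filling *)

Section Sorting.

Variables mu nu : seq nat.
Hypothesis mu_anti : forall i, nth 0 mu i.+1 <= nth 0 mu i.
Implicit Types T U : filling mu nu.

Lemma same_rows_card_lt U T i x : same_rows U T ->
  #|[set c : cell mu | (row_of c == i) && (U c < x)]| =
  #|[set c : cell mu | (row_of c == i) && (T c < x)]|.
Proof.
move=> /same_rowsP sUT; rewrite !card_beta_lt; apply: eq_bigr => k _.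
have [lt_i | le_i] := ltnP i (size mu); first exact: (sUT k (Ordinal lt_i)).
by rewrite !beta_entry // nth_default // !big_nil.
Qed.

Lemma same_rows_rowsorted_inj U T1 T2 :
  rowsorted T1 -> rowsorted T2 -> same_rows U T1 -> same_rows U T2 -> T1 = T2.
Proof.
move=> sT1 sT2 sUT1 sUT2; apply/ffunP=> c; apply/val_inj/eqP.
have eq_lt x : (T1 c < x) = (T2 c < x).
  by rewrite !rowsorted_lt // -(same_rows_card_lt _ _ sUT1) (same_rows_card_lt _ _ sUT2).
rewrite eqn_leq; apply/andP; split; first by rewrite -ltnS eq_lt.
by rewrite -ltnS -eq_lt.
Qed.

(** Each row is sorted by inverting its cumulative count [N i]: column [j] receives the [k] with
    [N i k <= j < N i k.+1]. *)
Lemma rowsorted_exists U : exists2 T, rowsorted T & same_rows U T.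
Proof.
pose N i x := #|[set d | (row_of d == i) && (U d < x)]|.
have N_mono i : {homo N i : x y / x <= y}.
  move=> x y le_xy; apply/subset_leq_card/subsetP=> d; rewrite !inE => /andP[-> lt_x].
  exact: leq_trans le_xy.
have N_le i x : N i x <= nth 0 mu i.
  rewrite -(card_cell_row_lt mu_anti (leqnn (nth 0 mu i))).
  apply/subset_leq_card/subsetP=> d; rewrite !inE => /andP[/eqP<- _].
  by rewrite eqxx col_of_lt.
have /fin_all_exists[f Nf] : forall c : cell mu, exists k : 'I_(size nu),
    forall x, (k < x) = (col_of c < N (row_of c) x).
  move=> c; apply: threshold_exists => //.
  apply/andP; split; first by rewrite /N eq_card0 // => d; rewrite !inE andbF.
  apply: leq_trans (col_of_lt c) _.
  rewrite -{1}(card_cell_row_lt mu_anti (leqnn (nth 0 mu (row_of c)))).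
  apply/subset_leq_card/subsetP=> d; rewrite !inE => /andP[-> _] /=.
  exact: ltn_ord.
pose T : filling mu nu := [ffun c => f c].
exists T.
  apply/forallP=> c; apply/forallP=> d; apply/implyP=> /andP[/eqP eq_r le_c].
  rewrite !ffunE -ltnS Nf eq_r; apply: leq_ltn_trans le_c _.
  by rewrite -Nf.
have NT i x : #|[set c : cell mu | (row_of c == i) && (T c < x)]| = N i x.
  rewrite -[RHS](card_cell_row_lt mu_anti (N_le i x)); apply: eq_card => c.
  by rewrite !inE ffunE Nf; case: eqP => // ->.
apply/same_rowsP=> k i.
have beta_N V : beta V k i = #|[set c : cell mu | (row_of c == i) && (V c < k.+1)]| -
                             #|[set c : cell mu | (row_of c == i) && (V c < k)]|.
  rewrite !card_beta_lt (bigD1 k) //= -[LHS](addnK (\sum_(l < size nu | l < k) beta V l i)).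
  congr (_ + _ - _); apply: eq_bigl => l.
  by rewrite ltnS [RHS]andbC -val_eqE /= ltn_neqAle.
by rewrite !beta_N !NT.
Qed.

(* If (i, j) and (i+1, j) are cells and x is the entry of T in the latter, row
   i+1 of U has more than j entries that are at most x, and the entries
   above them are smaller than x. *)
Lemma same_rows_colstrict U T :
  colstrict U -> rowsorted T -> same_rows U T -> colstrict T.
Proof.
move=> colU sT sUT; apply/colstrictP => // i j lt_j.
have [d [rd cd]] := cell_exists mu_anti lt_j.
have [c [rc cc]] := cell_exists mu_anti (leq_trans lt_j (mu_anti i)).
rewrite -rd -{1}rc -{1}cc -cd !entryE rowsorted_lt // cc.
have: T d < (T d).+1 by [].
rewrite {1}rowsorted_lt // cd => /leq_trans; apply.
rewrite -!(same_rows_card_lt _ _ sUT) rc rd.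
(* On row [i.+1], [up] moves to the cell above. It injects the cells of that row where [U] is at
   most [T d] into the cells of row [i] where [U] is below [T d]. *)
have /fin_all_exists[up upP] : forall e : cell mu, exists e' : cell mu,
    row_of e = i.+1 -> row_of e' = i /\ col_of e' = col_of e.
  move=> e; case: (eqVneq (row_of e) i.+1) => [eq_r | neq_r]; last first.
    by exists e => eq_r; rewrite eq_r eqxx in neq_r.
  have lt_e: col_of e < nth 0 mu i.
    by rewrite (leq_trans (col_of_lt e)) // eq_r.
  by have [e' e'P] := cell_exists mu_anti lt_e; exists e'.
rewrite -(card_in_imset (f := up)).
  apply/subset_leq_card/subsetP=> _ /imsetP[e + ->]; rewrite !inE ltnS.
  move=> /andP[/eqP eq_r le_e]; have [ru cu] := upP e eq_r.
  rewrite ru eqxx; apply: leq_trans le_e.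
  by rewrite -!entryE ru cu eq_r; apply: (colstrictP _ _ colU) => //; rewrite -eq_r col_of_lt.
move=> e1 e2; rewrite !inE => /andP[/eqP r1 _] /andP[/eqP r2 _] eq_up.
apply: cell_eq; first by rewrite r1.
by rewrite -(upP e1 r1).2 -(upP e2 r2).2 eq_up.
Qed.

Lemma card_sorting U : colstrict U ->
  #|[set T | [&& rowsorted T, colstrict T & same_rows U T]]| = 1.
Proof.
move=> colU; have [T sT sUT] := rowsorted_exists U.
apply/eqP/cards1P; exists T; apply/setP=> T'; rewrite !inE.
apply/and3P/eqP => [[sT' _ sUT'] | ->].
  exact: same_rows_rowsorted_inj sUT' sUT.
by split=> //; apply: same_rows_colstrict sUT.
Qed.

(** The content is the sum of the row contents, so it passes between [U] and [T]; only
    column-strictness has to be exchanged. *)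
Lemma same_rows_content U T : same_rows U T ->
  (U \in colstrict_fillings mu nu) && colstrict T =
  (T \in colstrict_fillings mu nu) && colstrict U.
Proof.
move=> /same_rowsP sUT; rewrite !inE andbAC [RHS]andbAC (andbC (colstrict T)).
congr (_ && _); apply: eq_forallb => k; rewrite -!sum_beta_content.
by rewrite (eq_bigr (fun i : 'I_(size mu) => beta T k i)).
Qed.

End Sorting.

(** * Column-strict rearrangements of a tableau *)

Section Rearrangements.

Variables mu nu : seq nat.
Hypothesis mu_anti : forall i, nth 0 mu i.+1 <= nth 0 mu i.
Implicit Types T U V : filling mu nu.

Let w := head 0 mu.
Let h := size mu.

Definition first_cols (m : nat) : {set 'I_w} := [set x : 'I_w | x < m].

Definition row_perms : {set {ffun 'I_h -> 'S_w}} :=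
  [set s : {ffun 'I_h -> 'S_w} | [forall i : 'I_h, s i \in Sym (first_cols (nth 0 mu i))]].

Definition rearranges (s : {ffun 'I_h -> 'S_w}) U T : bool :=
  [forall i : 'I_h, forall j : 'I_w,
    (j < nth 0 mu i) ==> (entry U i j == entry T i (s i j))].

Lemma row_perms_lt s (i : 'I_h) (j : 'I_w) : s \in row_perms ->
  (s i j < nth 0 mu i) = (j < nth 0 mu i).
Proof.
by rewrite inE => /forallP/(_ i); rewrite inE => /(perm_closed j); rewrite !inE.
Qed.

Lemma card_rearranging U T :
  #|[set s in row_perms | rearranges s U T]| =
  if same_rows U T then \prod_(i < h) \prod_(k < size nu) (beta T k i)`! else 0.
Proof.
rewrite -prod_ffact_beta //.
pose Q (i : 'I_h) := [set t : 'S_w | perm_on [set x : 'I_w | x < nth 0 mu i] t &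
  [forall j : 'I_w, (j < nth 0 mu i) ==> (entry U i j == entry T i (t j))]].
transitivity #|family (fun i => mem (Q i))|.
  apply: eq_card => s; rewrite !inE; apply/andP/familyP.
    by move=> [/forallP sH /forallP sQ] i; have := sH i; rewrite !inE => ->; apply: sQ.
  move=> sQ; split; apply/forallP=> i; have := sQ i; rewrite !inE; first by case/andP.
  by case/andP.
rewrite card_family foldrE big_image; apply: eq_bigr => i _.
rewrite (@card_perms_matching _ _ (size nu)) ?nth_part_le_head // => [|j lt_j];
  last exact: entry_lt.
by apply: eq_bigr => k _; rewrite !beta_entry.
Qed.

(** The witness is [T] composed with [s]. Characterizing every [V] lets a sum over rearrangements
    collapse to one term. *)
Lemma rearranged_exists s T : s \in row_perms ->
  exists U, forall V, rearranges s V T = (V == U).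
Proof.
move=> sH.
have entry_fun V : (forall c : cell mu, V c = entry T (row_of c) (s (val c).1 (val c).2) :> nat) <->
    rearranges s V T.
  split=> [VT | /forallP VT c].
    apply/forallP=> i; apply/forallP=> j; apply/implyP=> lt_j.
    have [c [rc cc]] := cell_exists mu_anti lt_j.
    have [-> ->]: i = (val c).1 /\ j = (val c).2 by split; apply: val_inj.
    by have := VT c; rewrite -entryE => /eqP.
  have /forallP/(_ (val c).2)/implyP := VT (val c).1.
  by move=> /(_ (col_of_lt c))/eqP <-; rewrite entryE.
have /fin_all_exists[f fP] : forall c : cell mu, exists d : cell mu,
    row_of d = row_of c /\ col_of d = s (val c).1 (val c).2.
  move=> c; apply: cell_exists => //.
  by rewrite (row_perms_lt (val c).1 (val c).2 sH) col_of_lt.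
exists [ffun c => T (f c)] => V; apply/idP/eqP => [/entry_fun VT | ->].
  apply/ffunP=> c; apply: val_inj; rewrite ffunE /= VT.
  by have [<- <-] := fP c; rewrite entryE.
by apply/entry_fun => c; rewrite ffunE; have [<- <-] := fP c; rewrite entryE.
Qed.

Definition compatible T (i : nat) (t : 'S_w) : bool :=
  [forall j : 'I_w, (j < nth 0 mu i.+1) ==> (entry T i (t j) < entry T i.+1 j)].

(** Column [j'] of [U] compares [T] at [s i j'] in row [i] with [T] at [s i.+1 j'] in row [i.+1].
    Substituting [j = s i.+1 j'] leaves only the quotient. For the last row the condition is
    vacuous. *)
Lemma rearranges_colstrict s U T : s \in row_perms -> rearranges s U T ->
  colstrict U =
  [forall i : 'I_h, compatible T i ((ext1 s i.+1)^-1 * s i)%g].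
Proof.
move=> sH sUT.
have entU (i : 'I_h) (j : 'I_w) : j < nth 0 mu i -> entry U i j = entry T i (s i j).
  by move=> lt_j; have /forallP/(_ i)/forallP/(_ j)/implyP/(_ lt_j)/eqP := sUT.
apply/(colstrictP mu_anti)/forallP => [colU i | compT i j lt_j].
  apply/forallP=> j; apply/implyP=> lt_j.
  pose i' := Ordinal (nth_part_gt0 lt_j).
  rewrite (ext1_ord s i') permM.
  pose j' := (s i')^-1%g j; have def_j: j = s i' j' by rewrite permKV.
  have lt_j': j' < nth 0 mu i' by rewrite -(row_perms_lt i' j' sH) -def_j.
  rewrite -/j' def_j -entU; last exact: leq_trans lt_j' (mu_anti i).
  by rewrite -[i.+1]/(val i') -entU //; apply: colU.
pose i1 := Ordinal (nth_part_gt0 lt_j).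
pose i0 := Ordinal (ltnW (nth_part_gt0 lt_j)).
have lt_jw := leq_trans lt_j (nth_part_le_head mu_anti _).
pose j' := Ordinal lt_jw.
have -> : entry U i.+1 j = entry U i1 j' by [].
have -> : entry U i j = entry U i0 j' by [].
rewrite !entU //; last exact: leq_trans lt_j (mu_anti i).
have /forallP/(_ (s i1 j'))/implyP := compT i0.
rewrite (ext1_ord s i1) permM permK; apply.
by rewrite (row_perms_lt i1 j' sH).
Qed.

(** The first [j] entries of row [i] are at most the entry above [c], hence below that of [c];
    subtracting [j] discards exactly these. *)
Lemma rstat_entry T c i j : rowsorted T -> colstrict T ->
  row_of c = i.+1 -> col_of c = j ->
  rstat T c = \sum_(0 <= x < nth 0 mu i) (entry T i x < entry T i.+1 j) - j.
Proof.
move=> /(rowsortedP mu_anti) rowT /(colstrictP mu_anti) colT rc cc.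
have lt_j: j < nth 0 mu i.+1 by rewrite -rc -cc col_of_lt.
have -> : rstat T c = \sum_(0 <= x < nth 0 mu i) ((j <= x) && (entry T i x < entry T i.+1 j)).
  rewrite -(card_cell_row mu_anti i (fun x => (j <= x) && (entry T i x < entry T i.+1 j))).
  apply: eq_card => d; rewrite !inE rc cc eqSS; case: eqP => //= rd.
  by rewrite -(entryE T d) -(entryE T c) rc cc rd.
have le_j: j <= nth 0 mu i by rewrite ltnW // (leq_trans lt_j).
rewrite [in RHS](big_cat_nat _ le_j) //= (big_cat_nat _ le_j) //=.
rewrite big_nat big1 => [|x /andP[_ lt_x]]; last by rewrite leqNgt lt_x.
have -> : \sum_(0 <= x < j) (entry T i x < entry T i.+1 j) = j.
  rewrite -[RHS](sum_nat_ltn (leqnn j)) big_nat [RHS]big_nat.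
  apply: eq_bigr => x /andP[_ lt_x].
  by rewrite lt_x (leq_ltn_trans (rowT i x j _)) ?colT // (ltnW lt_x) (leq_trans lt_j).
rewrite addKn add0n big_nat [RHS]big_nat.
by apply: eq_bigr => x /andP[-> _].
Qed.

Lemma prod_rstat T : rowsorted T -> colstrict T ->
  \prod_(c : cell mu | 0 < row_of c) rstat T c =
  \prod_(i < h) \prod_(0 <= j < nth 0 mu i.+1)
     (\sum_(0 <= x < nth 0 mu i) (entry T i x < entry T i.+1 j) - j).
Proof.
move=> sT colT.
pose F i j := \sum_(0 <= x < nth 0 mu i) (entry T i x < entry T i.+1 j) - j.
pose G i j := if i is i'.+1 then F i' j else 1.
rewrite big_mkcond (eq_bigr (fun c : cell mu => G (row_of c) (col_of c))); last first.
  by move=> c _; case rc: (row_of c) => [|i] //=; apply: rstat_entry rc _.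
rewrite (big_cell mu_anti _ G) -(big_mkord xpredT (fun i => \prod_(0 <= j < nth 0 mu i.+1) F i j)).
rewrite /h; case sz: (size mu) => [|h']; first by rewrite !big_nil.
(* On the left the top row contributes 1. On the right the last factor is an empty product, the row
   after the last having length 0. *)
rewrite big_nat_recl //= big1 // mul1n big_nat_recr //= [nth 0 mu _]nth_default ?sz //.
by rewrite big_nil muln1.
Qed.

Lemma card_rearrangements T : rowsorted T -> colstrict T ->
  #|[set U | colstrict U & same_rows U T]| *
    \prod_(i < h) \prod_(k < size nu) (beta T k i)`! =
  \prod_(i < h) (nth 0 mu i - nth 0 mu i.+1)`! *
    \prod_(c : cell mu | 0 < row_of c) rstat T c.
Proof.
move=> sT colT; have /(rowsortedP mu_anti) rowT := sT.
(* Both sides count the [s] whose rearrangement of [T] is column-strict: on the left by the filling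
   obtained, on the right by quotients. *)
transitivity #|[set s in row_perms |
    [forall i : 'I_h, compatible T i ((ext1 s i.+1)^-1 * s i)%g]]|.
  transitivity (\sum_(U | colstrict U) #|[set s in row_perms | rearranges s U T]|).
    under eq_bigr => U _ do rewrite card_rearranging.
    by rewrite -big_mkcondr /= sum_nat_const cardsE.
  under eq_bigr => U _ do rewrite -sum1_card big_mkcond /=.
  rewrite exchange_big /= -[RHS]sum1_card big_mkcond [RHS]big_mkcond /=.
  apply: eq_bigr => s _; rewrite inE -big_mkcondr /=.
  case sH: (s \in row_perms); last first.
    by rewrite big1 // => U; rewrite inE sH andbF.
  have [U0 sU0] := rearranged_exists T sH.
  under eq_bigl => U do rewrite inE sH sU0 /=.
  rewrite -(rearranges_colstrict sH (U := U0)) ?sU0 //.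
  rewrite (eq_bigl (fun U => (U == U0) && colstrict U0)).
    by case: (colstrict U0); [rewrite (big_pred1 U0) // => U; rewrite andbT
                             | rewrite big1 // => U; rewrite andbF].
  by move=> U; case: eqP => [->|]; rewrite ?andbT ?andbF.
rewrite prod_rstat // -big_split /=.
have HS i : Sym (first_cols (nth 0 mu i.+1)) \subset Sym (first_cols (nth 0 mu i)).
  apply/subsetP=> t; rewrite !inE => /subset_trans; apply.
  by apply/subsetP=> x; rewrite !inE => /leq_trans; apply.
(* Each condition involves a single quotient, so the count factors over the rows. *)
transitivity (\prod_(i < h) #|[set t in Sym (first_cols (nth 0 mu i)) | compatible T i t]|).
  rewrite -(card_telescope h (H := fun i => Sym_group (first_cols (nth 0 mu i)))
    (compatible T) HS).
  by apply: eq_card => s; rewrite !inE.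
apply: eq_bigr => i _.
rewrite -(@card_perms_below w (nth 0 mu i) _ (entry T i) (entry T i.+1)) ?nth_part_le_head //.
  by apply: eq_card => t; rewrite !inE.
exact: rowT.
Qed.

End Rearrangements.

(** * 0-1 matrices as column-strict fillings *)

Section ConjugatePartition.

Variable lam : seq nat.
Hypothesis lamP : is_partition lam.

Lemma nth_conj_part i : nth 0 (conj_part lam) i = count (fun p => i < p) lam.
Proof.
have [lt_i | le_i] := ltnP i (head 0 lam); first by rewrite nth_mkseq.
rewrite nth_default ?size_mkseq //; apply/esym/eqP; rewrite -leqn0 leqNgt -has_count.
apply/hasPn=> p p_lam; rewrite -leqNgt; apply: leq_trans le_i.
case/andP: lamP => + _; case: (lam) p_lam => //= a l; rewrite inE => /orP[/eqP-> //|p_l].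
rewrite (path_sortedE (rev_trans leq_trans)) => /andP[/allP le_a _].
exact: le_a.
Qed.

(** Conjugation transposes the diagram: in a decreasing list the parts larger than [i] come
    first. *)
Lemma ltn_conj_part i j : (j < nth 0 (conj_part lam) i) = (i < nth 0 lam j).
Proof.
rewrite nth_conj_part; case/andP: lamP => + _.
elim: (lam) j => [|a l IHl] j /=; first by rewrite nth_nil ltn0.
rewrite (path_sortedE (rev_trans leq_trans)) => /andP[/allP le_a sl].
have [lt_ia | le_ai] := ltnP i a; first by case: j => [|j] //=; rewrite ltnS IHl.
have -> : count (fun p => i < p) l = 0.
  apply/eqP; rewrite -leqn0 leqNgt -has_count.
  by apply/hasPn=> p /le_a le_p; rewrite -leqNgt (leq_trans le_p).
case: j => [|j] /=; first by rewrite ltnn ltnNge le_ai.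
rewrite ltn0 ltnNge; apply/esym/negbF; apply: leq_trans le_ai.
have [lt_j | le_j] := ltnP j (size l); last by rewrite nth_default.
by apply: le_a; apply: mem_nth.
Qed.

Lemma conj_part_anti i : nth 0 (conj_part lam) i.+1 <= nth 0 (conj_part lam) i.
Proof. by rewrite !nth_conj_part; apply: sub_count => p /ltnW. Qed.

Lemma head_conj_part : head 0 (conj_part lam) = size lam.
Proof.
rewrite -nth0 nth_conj_part; apply/eqP; rewrite -all_count.
apply/allP=> p p_lam; rewrite lt0n; apply: contraL p_lam => /eqP->.
by case/andP: lamP.
Qed.

(** Turns the factorials of row-length differences into factorials of multiplicities. *)
Lemma conj_part_sub i :
  nth 0 (conj_part lam) i - nth 0 (conj_part lam) i.+1 = count_mem i.+1 lam.
Proof.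
rewrite !nth_conj_part; apply/eqP; rewrite -(eqn_add2r (count (fun p => i.+1 < p) lam)).
rewrite subnK; last by apply: sub_count => p /ltnW.
elim: (lam) => //= p l /eqP->; rewrite [i < p]leq_eqVlt [i.+1 == p]eq_sym.
by case: ltngtP => //=; lia.
Qed.

End ConjugatePartition.

Section Matrices.

Variables lam nu : seq nat.
Hypothesis lamP : is_partition lam.

Let mu := conj_part lam.
Let n := size nu.
Implicit Types U : filling mu nu.

Let mu_anti := conj_part_anti lamP.

(** Columns of the diagram of [mu] correspond to parts of [lam], hence to matrix rows; row [j] is
    the indicator of the set of entries in column [j]. *)
Definition matrix_of U : 'M[bool]_(size lam, n) :=
  \matrix_(j, k) [exists c : cell mu, (col_of c == j) && (U c == k)].

(** Strictness forbids repeating an entry within a column. *)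
Lemma card_entry_in_col U (j : 'I_(size lam)) (k : 'I_n) : colstrict U ->
  #|[set c : cell mu | (col_of c == j) && (U c == k)]| = matrix_of U j k.
Proof.
move=> /forallP colU; rewrite mxE; case: existsP => [[c /andP[/eqP cc /eqP Uc]] | noc].
  apply/eqP/cards1P; exists c; apply/setP=> d; rewrite !inE.
  apply/andP/eqP => [[/eqP cd /eqP Ud] | ->]; last by rewrite cc Uc !eqxx.
  apply: cell_eq; last by rewrite cc cd.
  have /forallP/(_ d)/implyP := colU c; have /forallP/(_ c)/implyP := colU d.
  rewrite cc cd eqxx Uc Ud ltnn /=; case: ltngtP => // _.
    by move=> /(_ isT).
  by move=> _ /(_ isT).
rewrite eq_card0 // => c; rewrite !inE; apply/negP=> cP; apply: noc.
by exists c.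
Qed.

Lemma col_of_lt_size (c : cell mu) : col_of c < size lam.
Proof. by rewrite -(head_conj_part lamP); apply: ltn_ord. Qed.

Definition col_ord (c : cell mu) : 'I_(size lam) := Ordinal (col_of_lt_size c).

Lemma card_col_matrix U (j : 'I_(size lam)) x : colstrict U ->
  #|[set c : cell mu | (col_of c == j) && (U c < x)]| =
  \sum_(k < n | k < x) matrix_of U j k.
Proof.
move=> colU; rewrite -sum1_card.
rewrite (partition_big (fun c : cell mu => U c) (fun k : 'I_n => k < x)) /=.
  apply: eq_bigr => k lt_kx; rewrite -card_entry_in_col // -sum1_card.
  apply: eq_bigl => c; rewrite !inE -andbA; case: eqP => //= _.
  by case: eqP => [->|]; rewrite ?andbF // lt_kx.
by move=> c; rewrite inE => /andP[].
Qed.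

Lemma row_sum_matrix U (j : 'I_(size lam)) : colstrict U ->
  \sum_(k < n) matrix_of U j k = nth 0 lam j.
Proof.
move=> colU; rewrite -(card_cell_col_lt mu_anti (j := j) (m := nth 0 lam j)).
  rewrite (eq_bigl (fun k : 'I_n => k < n)); last by move=> k; rewrite ltn_ord.
  rewrite -card_col_matrix //; apply: eq_card => c; rewrite !inE ltn_ord.
  by case: eqP => //= <-; rewrite -(ltn_conj_part lamP) col_of_lt.
by move=> i; rewrite (ltn_conj_part lamP).
Qed.

Lemma col_sum_matrix U (k : 'I_n) : colstrict U ->
  \sum_(j < size lam) matrix_of U j k = #|[set c : cell mu | U c == k]|.
Proof.
move=> colU; rewrite -[RHS]sum1_card (partition_big col_ord xpredT) //=.
apply: eq_bigr => j _; rewrite -card_entry_in_col // -sum1_card.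
by apply: eq_bigl => c; rewrite !inE andbC.
Qed.

(** Partial row sums of the matrix count the entries below [x] in each column, and by [colstrict_lt]
    these counts determine the filling. *)
Lemma matrix_of_inj : {in colstrict_fillings mu nu &, injective matrix_of}.
Proof.
move=> U V; rewrite !inE => /andP[colU _] /andP[colV _] eqM.
apply/ffunP=> c; apply/val_inj/eqP.
have eq_lt x : (U c < x) = (V c < x).
  rewrite !colstrict_lt //; have := card_col_matrix (col_ord c) x.
  by move=> /= cardE; rewrite !cardE // eqM.
rewrite eqn_leq; apply/andP; split; first by rewrite -ltnS eq_lt.
by rewrite -ltnS -eq_lt.
Qed.

Lemma matrix_of_onto (A : 'M[bool]_(size lam, n)) :
  (forall j, \sum_k A j k = nth 0 lam j) ->
  exists2 U, colstrict U & matrix_of U = A.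
Proof.
move=> rowA; pose C j x := \sum_(k < n | k < x) A j k.
have CS j (k : 'I_n) : C j k.+1 = C j k + A j k.
  rewrite /C (bigD1 k) //= addnC; congr (_ + _); apply: eq_bigl => l.
  by rewrite ltnS [RHS]ltn_neqAle andbC -val_eqE.
have C_mono j : {homo C j : x y / x <= y}.
  move=> x y le_xy; rewrite /C [X in _ <= X](bigID (fun k : 'I_n => k < x)) /=.
  rewrite (eq_bigl (fun k : 'I_n => (k < y) && (k < x))) ?leq_addr // => k.
  by apply/idP/andP => [lt_x | []//]; rewrite (leq_trans lt_x).
have Cn j : C j n = nth 0 lam j.
  by rewrite -rowA; apply: eq_bigl => k; rewrite ltn_ord.
(* The cell in row [r] of column [j] receives the position of the [r]-th one, counted from 0, in row
   [j] of [A]. *)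
have /fin_all_exists[f fP] : forall c : cell mu, exists k : 'I_n,
    forall x, (k < x) = (row_of c < C (col_ord c) x).
  move=> c; apply: threshold_exists => //.
  by rewrite {1}/C big1 //= Cn -(ltn_conj_part lamP) col_of_lt.
pose U : filling mu nu := [ffun c => f c].
exists U.
  apply/forallP=> c; apply/forallP=> d; apply/implyP=> /andP[/eqP eq_c lt_r].
  rewrite !ffunE fP; apply: leq_trans lt_r _.
  have -> : col_ord c = col_ord d by apply: val_inj.
  have: f d < (f d).+1 by [].
  (* [C] grows by at most 1 at each step, so distinct rows of a column receive distinct
     positions. *)
  rewrite {1}fP CS -[in X in _ -> X]ltnS => /leq_trans; apply.
  by rewrite -addn1 leq_add2l; case: (A _ _).
apply/matrixP=> j k; rewrite mxE; apply/existsP/idP => [[c] | Ajk].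
  rewrite ffunE => /andP[/eqP cc /eqP fc].
  have <-: col_ord c = j by apply: val_inj.
  have := fP c k; have := fP c k.+1; rewrite fc ltnSn ltnn CS.
  by case: (A _ _) => //=; rewrite addn0 => <-.
(* A one at [(j, k)] has [C j k] ones before it, so it is recorded in row [C j k] of column [j]. *)
have lt_r: j < nth 0 mu (C j k).
  rewrite (ltn_conj_part lamP) -Cn; apply: leq_trans (C_mono j _ _ (ltn_ord k)).
  by rewrite CS Ajk addn1.
have [c [rc cc]] := cell_exists mu_anti lt_r; exists c.
have eq_c: col_ord c = j by apply: val_inj.
rewrite ffunE cc eqxx -val_eqE /= eqn_leq.
have -> : f c <= k by rewrite -ltnS fP eq_c rc CS Ajk addn1.
by rewrite leqNgt fP eq_c rc ltnn.
Qed.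

Lemma M01_colstrict_fillings : M01 lam nu = #|colstrict_fillings mu nu|.
Proof.
rewrite -(card_in_imset matrix_of_inj); apply: eq_card => A; rewrite !inE.
apply/andP/imsetP => [[/forallP rowA /forallP colA] | [U + ->]].
  have [j|U colU defA] := @matrix_of_onto A; first exact/eqP.
  exists U => //; rewrite inE colU; apply/forallP=> k.
  by rewrite -col_sum_matrix // defA.
rewrite inE => /andP[colU /forallP contU]; split; apply/forallP=> i.
  by rewrite row_sum_matrix.
by rewrite col_sum_matrix.
Qed.

End Matrices.

(** * Summation over semistandard tableaux *)

(** By [card_sorting] each column-strict filling of content [nu] sorts to exactly one semistandard
    tableau; the double sum is then exchanged. *)
Lemma sum_SSYT_same_rows mu nu :
  (forall i, nth 0 mu i.+1 <= nth 0 mu i) ->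
  #|colstrict_fillings mu nu| =
  \sum_(T in SSYT mu nu) #|[set U : filling mu nu | colstrict U & same_rows U T]|.
Proof.
move=> mu_anti.
transitivity (\sum_(T in SSYT mu nu)
    \sum_(U in colstrict_fillings mu nu) same_rows U T); last first.
  apply: eq_bigr => T; rewrite SSYT_E => /andP[_ T_CS].
  rewrite -[RHS]sum1_card big_mkcond [RHS]big_mkcond /=; apply: eq_bigr => U _.
  rewrite [in RHS]inE; case sUT: (same_rows U T); last by rewrite andbF; case: ifP.
  have colT: colstrict T by move: T_CS; rewrite inE => /andP[].
  by have := same_rows_content sUT; rewrite colT T_CS !andbT => ->.
rewrite exchange_big /= -sum1_card; apply: eq_bigr => U U_CS.
have colU: colstrict U by move: U_CS; rewrite inE => /andP[].
rewrite -[LHS](card_sorting mu_anti colU) -sum1_card big_mkcond [RHS]big_mkcond /=.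
apply: eq_bigr => T _; rewrite SSYT_E inE.
case: (rowsorted T) => //=.
case sUT: (same_rows U T); last by rewrite andbF; case: ifP.
by have := same_rows_content sUT; rewrite colU U_CS !andbT /= => ->.
Qed.

Import GRing.Theory Num.Theory.

Theorem corollary5p5 (lam nu : seq nat)
    (lamP : is_partition lam) (nuP : is_partition nu) :
  ((M01 lam nu)%:R =
   (\prod_(1 <= i < (head 0 lam).+1) (count_mem i lam)`!)%N%:R
     / (\prod_(i < size nu) (nth 0 nu i)`!)%N%:R
   * \sum_(T in SSYT (conj_part lam) nu)
       (\prod_(c : cell (conj_part lam) | 0 < row_of c) rstat T c)%N%:R
       * \prod_(i < size nu) beta_multinomial T i :> rat)%R.
Proof.
have mu_anti := conj_part_anti lamP.
rewrite M01_colstrict_fillings // (sum_SSYT_same_rows nu mu_anti) natr_sum mulr_sumr.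
apply: eq_bigr => T; rewrite SSYT_E => /andP[sT]; rewrite inE => /andP[colT _].
have := card_rearrangements mu_anti sT colT.
set N := #|_|; set R := \prod_(c | _) _ => NE.
have multE : (\prod_(1 <= i < (head 0 lam).+1) (count_mem i lam)`! =
    \prod_(i < size (conj_part lam))
      (nth 0 (conj_part lam) i - nth 0 (conj_part lam) i.+1)`!)%N.
  rewrite big_add1 /= size_mkseq -(big_mkord xpredT (fun i =>
    (nth 0 (conj_part lam) i - nth 0 (conj_part lam) i.+1)`!)).
  by apply: eq_bigr => i _; rewrite conj_part_sub.
rewrite multE; move: NE; set F := (\prod_(i < size (conj_part lam)) (_ - _)`!)%N.
set B := (\prod_(i < size (conj_part lam)) \prod_(k < _) _)%N => NE.
set P := (\prod_(i < size nu) (nth 0 nu i)`!)%N.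
have P_neq0 : (P%:R != 0 :> rat)%R.
  by rewrite pnatr_eq0 -lt0n prodn_gt0 // => i; apply: fact_gt0.
have B_neq0 : (B%:R != 0 :> rat)%R.
  rewrite pnatr_eq0 -lt0n prodn_gt0 // => i; apply: prodn_gt0 => k.
  exact: fact_gt0.
(* The multinomial denominators run over entries first and [B] over rows first. Clearing [B] then
   makes the count [NE] applicable, and [P] cancels. *)
have -> : (\prod_(i < size nu) beta_multinomial T i = P%:R / B%:R)%R.
  by rewrite prodf_div -!natr_prod [in RHS]/B exchange_big.
apply: (mulIf B_neq0); rewrite -natrM NE natrM.
by field; rewrite B_neq0 P_neq0.
Qed.
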